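(* Let $\mathbb{K}$ be a field of characteristic $0$, let $s\ge 1$, let $e=(e_1,\dots,e_s)\in\mathcal{P}_s$ and let $S$ be a finite nonempty subset of $\mathbb{K}$. Let $a_1,\dots,a_s$ be selected at random independently and uniformly from $S$. Then $$\Pr\Big[\{(x-a_i)^{e_i} : 1\le i\le s\}\ \text{is linearly independent}\Big]\ \ge\ 1-\frac{s(s-1)}{|S|}.$$
   Context: $\mathbb{N}$ contains $0$. $\mathcal{P}_s$ denotes the set of sequences $e=(e_1,\dots,e_s)\in\mathbb{N}^s$ satisfying the Pólya condition: with $n_i=|\{j : e_j<i\}|$, one has $n_i\le i$ for all integers $i\ge 0$. Linear independence is over $\mathbb{K}$ in $\mathbb{K}[x]$. *)

(* Defs.v *)
From HB Require Import structures.
From mathcomp Require Import all_boot all_order all_algebra.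
From mathcomp Require Import finmap boolp.

Set Implicit Arguments.
Unset Strict Implicit.
Unset Printing Implicit Defensive.

Import Order.TTheory GRing.Theory Num.Theory.
Local Open Scope ring_scope.

Definition polya_condition (s : nat) (e : 'I_s -> nat) : Prop :=
  forall i : nat, (#|[set j : 'I_s | (e j < i)%N]| <= i)%N.

(* [free] from vector.v does not apply to {poly K}, which is not finite
   dimensional.  Independence is that of the indexed family: a repeated
   vector makes it dependent. *)
Definition lin_indep (K : fieldType) (V : lmodType K) (s : nat)
    (v : 'I_s -> V) : Prop :=
  forall c : 'I_s -> K, \sum_(i < s) c i *: v i = 0 -> forall i, c i = 0.

Definition shifted_powers (K : fieldType) (s : nat) (e : 'I_s -> nat)
    (a : 'I_s -> K) : 'I_s -> {poly K} :=
  fun i => ('X - (a i)%:P) ^+ e i.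

(* Probability of [E a] when the coordinates of [a] are drawn independently and
   uniformly from [S]: by independence, each outcome in S^s has weight the
   product of the s marginal weights 1/|S|. *)
Definition prob_iid_uniform (T : choiceType) (S : {fset T}) (s : nat)
    (E : ('I_s -> T) -> Prop) : rat :=
  \sum_(a : {ffun 'I_s -> S} | `[< E (fun i => val (a i)) >])
    \prod_(i < s) (#|` S|%fset%:R)^-1.

(* Main.v *)
Require Import Defs.
From HB Require Import structures.
From mathcomp Require Import all_boot all_order all_algebra.
From mathcomp Require Import finmap boolp.

Set Implicit Arguments.
Unset Strict Implicit.
Unset Printing Implicit Defensive.

Import Order.TTheory GRing.Theory Num.Theory.
Local Open Scope ring_scope.

(** The proof is a union bound that adds the vectors one index at a time.

    Fix a nonempty set [A] of indices.  By the Polya condition fewer than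
    [#|A|] indices have exponent below [#|A| - 1], so some [j] in [A] has [e j >= #|A| - 1].
    The family indexed by [A] can only be dependent if the one indexed by
    [A :\ j] is, or if the power with index [j] lies in the span of the others
    ([indep_on_add]).  Freeze all coordinates of the outcome but the one at [j]:
    the span is then fixed, of dimension [d <= #|A| - 1 <= e j], and at most [d]
    points [t] satisfy that [('X - t) ^+ e j] lies in it
    ([card_new_power_in_span]).  Indeed, [d + 1] such points would give [d + 1]
    powers with the common exponent [e j >= d], and these are independent in
    characteristic 0 ([lin_indep_equal_powers], a Vandermonde argument).
    So passing from [A :\ j] to [A] costs a probability at most
    [(#|A| - 1) / #|S|].  Summing over the indices, the family is dependent with
    probability at most ['C(s, 2) / #|S|]
    ([card_dependent_outcomes]). *)

(** * Independence and span of subfamilies *)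

(** Indexing subfamilies by subsets of a fixed index type lets an induction
    remove an arbitrary index without renumbering the others. *)
Definition indep_on (K : fieldType) (V : lmodType K) (I : finType)
    (A : {set I}) (v : I -> V) : Prop :=
  forall c : I -> K, \sum_(i in A) c i *: v i = 0 -> {in A, forall i, c i = 0}.

Definition in_span (K : fieldType) (V : lmodType K) (I : finType)
    (A : {set I}) (v : I -> V) (w : V) : Prop :=
  exists c : I -> K, w = \sum_(i in A) c i *: v i.

Lemma indep_on_setT (K : fieldType) (V : lmodType K) (s : nat)
    (v : 'I_s -> V) : indep_on [set: 'I_s] v -> lin_indep v.
Proof.
move=> indv c c0 i; apply: (indv c); last by rewrite inE.
by rewrite -[RHS]c0; apply: eq_bigl => k; rewrite inE.
Qed.

Lemma indep_on_add (K : fieldType) (V : lmodType K) (I : finType)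
    (A : {set I}) (j : I) (v : I -> V) :
  indep_on (A :\ j) v -> ~ in_span (A :\ j) v (v j) -> indep_on A v.
Proof.
move=> indv nspan c; have [jA|jNA] := boolP (j \in A); last first.
  suff <- : A :\ j = A by apply: indv.
  by apply/setDidPl; rewrite disjoint_sym disjoints1.
rewrite (big_setD1 j) //= => c0.
have cj0 : c j = 0.
  have [//|cj] := eqVneq (c j) 0; case: nspan.
  exists (fun i => - (c j)^-1 * c i).
  under eq_bigr do rewrite -scalerA.
  move/eqP: c0; rewrite -scaler_sumr addrC addr_eq0 => /eqP ->.
  by rewrite scalerN scaleNr opprK scalerA mulVf // scale1r.
move: c0; rewrite cj0 scale0r add0r => /indv c0 i iA.
by have [->//|ij] := eqVneq i j; apply: c0; rewrite !inE ij.
Qed.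

(** With more vectors [w k] than indices in [A], the matrix of their coordinates
    has a nonzero left kernel vector, which is a dependence relation. *)
Lemma lin_indep_span_leq (K : fieldType) (V : lmodType K) (I : finType)
    (A : {set I}) (v : I -> V) (m : nat) (w : 'I_m -> V) :
  lin_indep w -> (forall k, in_span A v (w k)) -> (m <= #|A|)%N.
Proof.
move=> indw /choice [c wE]; rewrite leqNgt; apply/negP => Am.
pose M := \matrix_(k < m, r < #|A|) c k (enum_val r).
have : kermx M != 0.
  by rewrite kermx_eq0 /row_free neq_ltn (leq_ltn_trans (rank_leq_col M)).
case/rowV0Pn => u /sub_kermxP uM /eqP; apply.
apply/rowP => k; rewrite mxE; apply: (indw (u 0)).
under eq_bigr => l _ do rewrite wE scaler_sumr.
rewrite exchange_big big_enum_val big1 //= => r _.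
move/rowP/(_ r): uM; rewrite !mxE => ur0.
under eq_bigr do rewrite scalerA.
rewrite -scaler_suml -[X in X *: _]/(\sum_l u 0 l * c l (enum_val r)).
rewrite (eq_bigr (fun l => u 0 l * M l r)) ?ur0 ?scale0r // => l _.
by rewrite mxE.
Qed.

(** * Shifted powers with a common exponent *)

Lemma coef_shifted_power (K : fieldType) (t : K) (e l : nat) : (l <= e)%N ->
  (('X - t%:P) ^+ e)`_(e - l) = (- t) ^+ l *+ 'C(e, l).
Proof.
move=> le_l_e; have lt_l_e : (l < e.+1)%N by [].
rewrite -polyCN exprDn coef_sum (bigD1 (Ordinal lt_l_e)) //=.
rewrite -polyC_exp coefMn coefMC coefXn eqxx mul1r big1 ?addr0 // => i.
rewrite -val_eqE /= => il; rewrite -polyC_exp coefMn coefMC coefXn.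
case: eqP => [eqd|]; last by rewrite mul0r mul0rn.
have ie : (i <= e)%N by rewrite -ltnS.
by case/eqP: il; rewrite -(subKn ie) -eqd subKn.
Qed.

(** The coefficients of ['X^(e - l)], for [l <= e], turn a dependence relation
    [c] into the vanishing of the moments [\sum_k c k * t k ^+ l], because the
    binomial coefficients are invertible in characteristic 0.  Then [c]
    annihilates the values of every polynomial of degree at most [e], in
    particular of the one that vanishes at all nodes but [t k]. *)
Lemma lin_indep_equal_powers (K : fieldType) (charK0 : [pchar K] =i pred0)
    (m e : nat) (t : 'I_m -> K) :
  injective t -> (m <= e.+1)%N -> lin_indep (shifted_powers (fun=> e) t).
Proof.
move=> tI le_m_e c c0.
have moment l : (l < e.+1)%N -> \sum_(k < m) c k * t k ^+ l = 0.
  rewrite ltnS => le_l_e; have := congr1 (fun p : {poly K} => p`_(e - l)) c0.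
  rewrite coef0 coef_sum.
  under eq_bigr => k _ do
    rewrite coefZ coef_shifted_power // exprNn -mulr_natr mulrA (mulrCA (c k)).
  under eq_bigr => k _ do rewrite -mulrA.
  rewrite -mulr_sumr -mulr_suml => /eqP.
  rewrite mulf_eq0 signr_eq0 mulf_eq0 /= => /orP[/eqP //|].
  by move/pcharf0P: charK0 => ->; rewrite -leqn0 leqNgt bin_gt0 le_l_e.
have annih (p : {poly K}) :
    (size p <= e.+1)%N -> \sum_(k < m) c k * p.[t k] = 0.
  move=> sp; under eq_bigr => k _ do rewrite (horner_coef_wide _ sp) mulr_sumr.
  rewrite exchange_big big1 //= => l _.
  under eq_bigr => k _ do rewrite mulrCA.
  by rewrite -mulr_sumr moment ?mulr0.
move=> k.
pose p := \prod_(i <- enum (predC1 k)) ('X - (t i)%:P).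
have /annih : (size p <= e.+1)%N.
  rewrite size_prod_XsubC -cardE cardC1 card_ord prednK //.
  exact: leq_ltn_trans (ltn_ord k).
have pE i : (p.[t i] == 0) = (i != k).
  rewrite -[_ == 0]/(root p (t i)) /p -(big_map t predT (fun x => 'X - x%:P)).
  by rewrite root_prod_XsubC mem_map // mem_enum.
rewrite (bigD1 k) //= big1 => [|i ik].
  by rewrite addr0 => /eqP; rewrite mulf_eq0 pE eqxx orbF => /eqP.
by move: ik; rewrite -pE => /eqP ->; rewrite mulr0.
Qed.

(** One point more than [#|A|] would give [#|A| + 1 <= e + 1] powers with the
    common exponent [e], hence independent, in a span of [#|A|] vectors. *)
Lemma card_new_power_in_span (K : fieldType) (charK0 : [pchar K] =i pred0)
    (I : finType) (A : {set I}) (v : I -> {poly K}) (e : nat) (S : {fset K}) :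
  (#|A| <= e)%N ->
  (#|[set t : S | `[< in_span A v (('X - (val t)%:P) ^+ e) >]]| <= #|A|)%N.
Proof.
move=> le_A_e; set T := [set t | _]; rewrite leqNgt; apply/negP => lt_A_T.
pose t (k : 'I_#|A|.+1) : K := val (enum_val (widen_ord lt_A_T k)).
have tI : injective t.
  by move=> k l /val_inj /enum_val_inj /(congr1 val) /= ?; apply: val_inj.
suff : (#|A|.+1 <= #|A|)%N by rewrite ltnn.
apply: (@lin_indep_span_leq _ _ _ A v _ (shifted_powers (fun=> e) t)).
  exact: lin_indep_equal_powers.
move=> k; have := enum_valP (widen_ord lt_A_T k).
by rewrite inE => /asboolP.
Qed.

(** * Counting the dependent outcomes *)

Definition upd (I T : finType) (j : I) (a : {ffun I -> T}) (t : T) :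
    {ffun I -> T} :=
  [ffun i => if i == j then t else a i].

(** A conditional bound gives an unconditional one: if, the other coordinates
    being given, at most [d] values of the coordinate [j] lead into [B], then a
    uniform outcome is in [B] with probability at most [d / #|T|].  The left
    side counts the pairs of an outcome in [B] and a fresh value.  Exchanging
    the fresh value with the coordinate [j] is an involution on all pairs, and
    it turns membership of the outcome in [B] into membership of the updated
    outcome. *)
Lemma card_bounded_fibres (I T : finType) (j : I) (B : {set {ffun I -> T}})
    (d : nat) :
  (forall a, #|[set t | upd j a t \in B]| <= d)%N ->
  (#|B| * #|T| <= d * #|T| ^ #|I|)%N.
Proof.
move=> fibre.
have -> : (#|B| * #|T| = \sum_(u : {ffun I -> T} * T) (u.1 \in B))%N.
  rewrite -(pair_bigA _ (fun a _ => (a \in B) : nat)) /=.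
  under eq_bigr => a _ do rewrite sum_nat_const.
  rewrite -big_distrr /= mulnC -[#|B|]sum1_card [in LHS]big_mkcond /=.
  by congr (_ * _)%N; apply: eq_bigr => a _; case: (a \in B).
pose swap u : {ffun I -> T} * T := (upd j u.1 u.2, u.1 j).
have swapK : involutive swap.
  case=> a t; rewrite /swap /=; congr pair; last by rewrite ffunE eqxx.
  by apply/ffunP => i; rewrite !ffunE; case: eqP => [->|].
rewrite (reindex_inj (can_inj swapK)) /=.
rewrite -(pair_bigA _ (fun a t => (upd j a t \in B) : nat)) /=.
rewrite mulnC -card_ffun -sum_nat_const; apply: leq_sum => a _.
apply: leq_trans (fibre a); rewrite -sum1dep_card [leqRHS]big_mkcond /=.
by apply: leq_sum => t _; case: (_ \in B).
Qed.

Definition dependent_outcomes (K : fieldType) (s : nat) (e : 'I_s -> nat)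
    (S : {fset K}) (A : {set 'I_s}) : {set {ffun 'I_s -> S}} :=
  [set a : {ffun _ -> S} |
    ~~ `[< indep_on A (shifted_powers e (fun i => val (a i))) >]].

(** In the induction on [#|A|], the identity
    ['C(m.+1, 2) = 'C(m, 2) + m] matches
    the two ways in which a family of [m.+1] vectors can be dependent.  After
    division by [#|S| ^ s.+1] this bounds a probability by
    ['C(#|A|, 2) / #|S|]. *)
Lemma card_dependent_outcomes (K : fieldType) (charK0 : [pchar K] =i pred0)
    (s : nat) (e : 'I_s -> nat) (e_polya : polya_condition e)
    (S : {fset K}) (A : {set 'I_s}) :
  (#|dependent_outcomes e S A| * #|` S| <= 'C(#|A|, 2) * #|` S| ^ s)%N.
Proof.
have [m] := ubnP #|A|; elim: m A => // m IHm A.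
have [->|A0] := eqVneq A set0.
  move=> _; rewrite cards0 bin0n mul0n leqn0 muln_eq0 cards_eq0.
  apply/orP; left; apply/eqP/setP => a; rewrite !inE; apply/negbTE.
  rewrite negbK.
  by apply/asboolP => c _ i; rewrite inE.
rewrite ltnS => Am.
(* If all exponents in A were below #|A|.-1, the Polya condition at #|A|.-1
   would bound #|A| by #|A|.-1. *)
have [j jA ej] : exists2 j, j \in A & (#|A|.-1 <= e j)%N.
  apply/exists_inP; apply: contraT; rewrite negb_exists_in => /forall_inP ltA.
  suff : (#|A| <= #|A|.-1)%N by rewrite leqNgt prednK ?leqnn ?card_gt0.
  apply: leq_trans (e_polya _); apply/subset_leq_card/subsetP => i /ltA.
  by rewrite inE ltnNge.
have cA : #|A| = #|A :\ j|.+1 by rewrite (cardsD1 j A) jA.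
rewrite cA /= in ej Am *.
(* N is the event that the vector at j adds nothing to the span of the others;
   that span is the same for all values of the coordinate j. *)
pose f (a : {ffun 'I_s -> S}) := shifted_powers e (fun i => val (a i)).
pose N := [set a : {ffun _ -> S} | `[< in_span (A :\ j) (f a) (f a j) >]].
have sub : dependent_outcomes e S A \subset
    dependent_outcomes e S (A :\ j) :|: N.
  apply/subsetP => a; rewrite !inE => /asboolPn depA.
  have [indA|//] := asboolP; rewrite /=; apply/asboolP.
  have [//|nspan] := pselect (in_span (A :\ j) (f a) (f a j)).
  by case: depA; apply: indep_on_add nspan.
apply: leq_trans
  (_ : (#|dependent_outcomes e S (A :\ j)| + #|N|) * #|` S| <= _)%N.
  rewrite leq_mul2r (leq_trans (subset_leq_card sub)) ?orbT //.
  by rewrite cardsU leq_subr.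
rewrite binS bin1 !mulnDl leq_add ?IHm //.
rewrite cardfE -[X in (_ ^ X)%N]card_ord.
apply: (@card_bounded_fibres _ _ j) => a.
apply: leq_trans (card_new_power_in_span charK0 (f a) S ej).
(* Updating the coordinate j leaves the vectors indexed by A :\ j alone. *)
apply/subset_leq_card/subsetP => t; rewrite !inE => /asboolP [c fj].
apply/asboolP; exists c.
move: fj; rewrite {1}/f /shifted_powers ffunE eqxx => ->.
apply: eq_bigr => i; rewrite !inE => /andP[ij _].
by rewrite /f /shifted_powers ffunE (negbTE ij).
Qed.

Theorem corollary3p8 (K : fieldType) (charK0 : [pchar K] =i pred0)
    (s : nat) (s_gt0 : (0 < s)%N)
    (e : 'I_s -> nat) (e_polya : polya_condition e)
    (S : {fset K}) (S_neq0 : S != fset0) :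
  prob_iid_uniform S (fun a : 'I_s -> K => lin_indep (shifted_powers e a))
    >= 1 - s%:R * (s%:R - 1) / #|` S|%fset%:R.
Proof.
have := card_dependent_outcomes charK0 e_polya S setT.
rewrite cardsT card_ord; set D := dependent_outcomes _ _ _.
have S0 : (0 < #|` S|)%N by rewrite cardfs_gt0.
set n := #|` S| in S0 *; move=> leD.
have n0 : 0 < n%:R :> rat by rewrite ltr0n.
rewrite /prob_iid_uniform; under eq_bigr do rewrite prodr_const card_ord exprVn.
rewrite sumr_const -/n -[leRHS]mulr_natl ler_pdivlMr ?exprn_gt0 //.
(* G counts the independent outcomes. *)
set G := (#|_|); have leG : (n ^ s <= #|D| + G)%N.
  rewrite -[X in (_ ^ X)%N]card_ord [n]cardfE -card_ffun -(cardsC D) leq_add2l.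
  apply/subset_leq_card/subsetP => a; rewrite !inE negbK => /asboolP indA.
  by apply/asboolP/indep_on_setT.
(* The factor 1/2 of 'C(s, 2) is given up here. *)
have leDn : (#|D| * n <= (s * s.-1) * n ^ s)%N.
  by apply: leq_trans leD _; rewrite leq_mul2r bin2 -divn2 leq_div ?orbT.
rewrite mulrBl mul1r -natrX lerBlDr -(ler_pM2r n0) mulrDl.
rewrite mulrAC divfK ?gt_eqF //.
rewrite -(natrB _ s_gt0) subn1 -!natrM -natrD ler_nat.
apply: leq_trans (leq_add (leqnn _) leDn).
by rewrite -mulnDl leq_mul2r addnC leG orbT.
Qed.
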